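(* Let $A$ be a finite set of prisoners with $|A|\ge2$, let $K$ be a finite set of colors with $3\le|K|$, let $V$ be a visibility graph on $A$, and let $I$ be an inning function on $A$ with $IN\ge2$. Suppose the hat game $\mathcal{G}=(A,K,V,I)$ satisfies: (S1) $|I_1|=1$; (S2) for every $a\in A$, $V(a)\cup H(a)=A\setminus\{a\}$. Then there is a predictor for $\mathcal{G}$ such that for every coloring, at most one prisoner guesses incorrectly.
   Context: A hat game $(A,K,V,I)$ consists of: a set $A$ of prisoners and a set $K$ of colors (with $|A|,|K|\ge2$); a visibility graph $V\subseteq A^2$ with no loops, where $(a,b)\in V$ means $a$ sees $b$'s hat, and $V(a)=\{b:(a,b)\in V\}$; and an inning function $I$, a surjection from $A$ onto $\{\beta:1\le\beta\le\alpha\}$ for some nonzero ordinal $\alpha$. Write $IN=\max\operatorname{ran}(I)$, $I_\beta=\{a:I(a)=\beta\}$, and $H(a)=\{b:I(b)<I(a)\}$. A coloring is $f\in K^A$. Strategies: for each $a$, a function $S_a:K^{H(a)}\times K^{V(a)}\to K$; guesses are defined by recursion on $I(a)$ as $\sigma_a(f)=S_a(h_a^f,f\restriction V(a))$ with $h_a^f=(\sigma_b(f))_{b\in H(a)}$. A predictor is $P:K^A\to K^A$ with $P(f)(a)=\sigma_a(f)$ for some family of strategies. Prisoner $a$ guesses incorrectly under $f$ if $P(f)(a)\ne f(a)$. *)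

(* Defs.v *)
From HB Require Import structures.
From mathcomp Require Import all_boot.
Set Implicit Arguments.
Unset Strict Implicit.
Unset Printing Implicit Defensive.

(* Colorings are [{ffun A -> K}]; [V a b] means that [a] sees the hat of [b].
   The theory is set up for a finite set [A] of prisoners. A surjection from a
   finite set onto the ordinals [1 <= beta <= alpha] forces [alpha] to be
   finite, so innings are natural numbers. *)

Definition inning_function (A : finType) (I : A -> nat) : Prop :=
  exists2 alpha : nat, alpha != 0
    & forall beta : nat, (beta \in codom I) = (1 <= beta <= alpha).

Section HatGame.
Variables (A K : finType) (V : rel A) (I : A -> nat).

Definition IN : nat := \max_(a : A) I a.

Definition inning_class (beta : nat) : {set A} := [set a | I a == beta].

Definition seen (a : A) : {set A} := [set b | V a b].

Definition heard (a : A) : {set A} := [set b | I b < I a].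

Definition strategies : Type :=
  forall a : A, {ffun {b : A | b \in heard a} -> K} ->
                {ffun {b : A | b \in seen a} -> K} -> K.

Lemma heard_wf : well_founded (fun b a : A => b \in heard a).
Proof.
move=> a; have [n] := ubnP (I a); elim: n a => [|n IHn] a; first by rewrite ltn0.
rewrite ltnS => le_a_n; apply: Acc_intro => b; rewrite inE => lt_ba.
exact: IHn (leq_trans lt_ba le_a_n).
Qed.

(* [guess S f a] is sigma_a(f), computed by recursion on the inning of [a]. *)
Definition guess (S : strategies) (f : {ffun A -> K}) : A -> K :=
  Fix heard_wf (fun=> K)
    (fun a sigma => S a [ffun b => sigma (val b) (valP b)]
                        [ffun b => f (val b)]).

Lemma guessE (S : strategies) (f : {ffun A -> K}) (a : A) :
  guess S f a = S a [ffun b => guess S f (val b)] [ffun b => f (val b)].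
Proof.
rewrite /guess Fix_eq // => {}a g h eq_gh.
by congr (S a _ _); apply/ffunP=> b; rewrite !ffunE.
Qed.

Definition predictor (P : {ffun A -> K} -> {ffun A -> K}) : Prop :=
  exists S : strategies, forall f a, P f a = guess S f a.

Definition incorrect (P : {ffun A -> K} -> {ffun A -> K}) (f : {ffun A -> K}) :
  {set A} := [set a | P f a != f a].

End HatGame.

(* Main.v *)
(** Transport an abelian group structure to the set of colors. The unique
prisoner [p] of the first inning sees everybody else and announces the sum of
their colors. Every other prisoner [a] hears [p], and by induction on the inning
the other guesses that [a] hears are correct; since [a] sees or hears all the
others, [a] recovers its own color by subtraction. So only [p] can be wrong. *)
Require Import Defs.
From HB Require Import structures.
From mathcomp Require Import all_boot.
From mathcomp Require Import ssralg zmodp.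
Set Implicit Arguments.
Unset Strict Implicit.
Unset Printing Implicit Defensive.

Section SumStrategy.
Variables (A K : finType) (V : rel A) (I : A -> nat) (G : zmodType).
Variables (enc : K -> G) (dec : G -> K) (k0 : K) (p : A).

(** A heard guess overrides a seen hat: a prisoner who both sees and hears [p] must use the
    announced sum, not the hat of [p]. Under [see_or_hear] below, the default [k0] is reached only
    at [b = a]. *)
Definition known (a : A) (h : {ffun {b : A | b \in heard I a} -> K})
    (v : {ffun {b : A | b \in seen V a} -> K}) (b : A) : K :=
  oapp h (oapp v k0 (insub b)) (insub b).

Definition sum_strategy : strategies K V I := fun a h v =>
  dec (if a == p then \sum_(b | b != p) enc (known h v b)
       else enc (known h v p)
            - \sum_(b | (b != p) && (b != a)) enc (known h v b))%R.

Lemma known_guess (S : strategies K V I) (f : {ffun A -> K}) (a b : A) :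
  known [ffun c : {c | c \in heard I a} => guess S f (val c)]
        [ffun c : {c | c \in seen V a} => f (val c)] b =
  if b \in heard I a then guess S f b else if b \in seen V a then f b else k0.
Proof.
have insubE (B : {set A}) (g : A -> K) (k : K) :
    oapp [ffun c : {c | c \in B} => g (val c)] k (insub b) =
    if b \in B then g b else k.
  by case: insubP => [u -> <- | /negPf->] //=; rewrite ffunE.
by rewrite /known !insubE.
Qed.

Hypotheses (encK : cancel enc dec) (decK : cancel dec enc).
Hypothesis p_first : forall a, a != p -> I p < I a.
Hypothesis see_or_hear : forall a, seen V a :|: heard I a = [set: A] :\ a.

Lemma seen_not_heard (a b : A) :
  b != a -> b \notin heard I a -> b \in seen V a.
Proof.
move=> neq_ba /negPf not_heard; have := in_setU b (seen V a) (heard I a).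
by rewrite see_or_hear not_heard orbF in_setD1 neq_ba inE => <-.
Qed.

(** Nobody precedes [p], so [p] hears no guess and by [see_or_hear] sees every other hat. *)
Lemma guess_first (f : {ffun A -> K}) :
  guess sum_strategy f p = dec (\sum_(b | b != p) enc (f b))%R.
Proof.
rewrite guessE /sum_strategy eqxx; congr dec; apply: eq_bigr => b neq_bp.
have not_heard : b \notin heard I p by rewrite inE -leqNgt ltnW ?p_first.
by rewrite known_guess (negPf not_heard) seen_not_heard.
Qed.

Lemma guess_correct (f : {ffun A -> K}) (a : A) :
  a != p -> guess sum_strategy f a = f a.
Proof.
have [n] := ubnP (I a); elim: n a => // n IHn a; rewrite ltnS => le_an neq_ap.
rewrite guessE /sum_strategy (negPf neq_ap) known_guess inE p_first //.
(* Decoding loses nothing: [enc] recovers the exact announced sum, from which the term of [a] is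
   split off. *)
rewrite guess_first decK (bigD1 a) //=.
rewrite [X in (_ - X)%R](_ : _ = \sum_(b | (b != p) && (b != a)) enc (f b))%R.
  by rewrite GRing.addrK encK.
(* A heard [b] has an earlier inning, so its guess is its color by induction; any other [b] is seen
   directly. *)
apply: eq_bigr => b /andP[neq_bp neq_ba]; rewrite known_guess.
case: ifPn => [heard_b | /(seen_not_heard neq_ba)->] //.
rewrite IHn //; rewrite inE in heard_b; exact: leq_trans heard_b le_an.
Qed.

End SumStrategy.

Theorem theorem4p3 (A K : finType) (V : rel A) (I : A -> nat)
    (cardA : 2 <= #|A|) (cardK : 3 <= #|K|)
    (V_noloop : irreflexive V) (I_inning : inning_function I)
    (IN_ge2 : 2 <= IN I)
    (S1 : #|inning_class I 1| = 1)
    (S2 : forall a : A, seen V a :|: heard I a = [set: A] :\ a) :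
  exists2 P : {ffun A -> K} -> {ffun A -> K},
    predictor V I P & forall f : {ffun A -> K}, #|incorrect P f| <= 1.
Proof.
have [p class_p] : exists p, inning_class I 1 = [set p].
  by apply/cards1P; rewrite S1.
(* Innings start at 1, and only [p] has inning 1. *)
have p_first a : a != p -> I p < I a.
  have Ip : I p = 1 by apply/eqP; have := set11 p; rewrite -class_p inE.
  have [alpha _ Ialpha] := I_inning.
  have /andP[Ia_gt0 _] : 1 <= I a <= alpha by rewrite -Ialpha codom_f.
  by rewrite -in_set1 -class_p inE Ip ltn_neqAle eq_sym Ia_gt0 andbT.
(* The group is the integers modulo [#|K|]; its structure on ordinals requires the bound in
   successor form. *)
case: (posnP #|K|) => [K0 | K_gt0]; first by rewrite K0 in cardK.
have cardKE : #|K| = #|K|.-1.+1 by rewrite prednK.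
pose enc (k : K) : 'I_#|K|.-1.+1 := cast_ord cardKE (enum_rank k).
pose dec (i : 'I_#|K|.-1.+1) : K := enum_val (cast_ord (esym cardKE) i).
have encK : cancel enc dec by move=> k; rewrite /dec cast_ordK enum_rankK.
have decK : cancel dec enc by move=> i; rewrite /enc enum_valK cast_ordKV.
pose S := @sum_strategy A K V I _ enc dec (dec ord0) p.
exists (fun f => [ffun a => guess S f a]); first by exists S => f a; rewrite ffunE.
move=> f; rewrite -(cards1 p); apply/subset_leq_card/subsetP=> a.
rewrite !inE ffunE; apply: contraR => neq_ap; apply/eqP.
exact: guess_correct encK decK p_first S2 f a neq_ap.
Qed.
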